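(* Let $A_1,\dots,A_r\in\mathbb{R}^{n\times n}$ be Metzler matrices with zero row sums, let $x_0\in\mathbb{R}^n$ and $T>0$. Let $u^*=(u_1^*,\dots,u_r^* )\in\mathcal{U}$ be an optimal control for the problem of minimizing $V(x(T,u))$ over $u\in\mathcal{U}$, and let $x^*:[0,T]\to\mathbb{R}^n$ be the corresponding trajectory of $$\dot x=\Big(\sum_{i=1}^r u_iA_i\Big)x,\qquad x(0)=x_0 .$$ Define the adjoint $\lambda:[0,T]\to\mathbb{R}^n$ as the solution of $$\dot\lambda(t)=-\Big(\sum_{i=1}^r u_i^*(t)A_i\Big)'\lambda(t),\qquad \lambda(T)=Px^*(T),$$ and define the switching functions $m_i(t):=\lambda'(t)A_ix^*(t)$, $i=1,\dots,r$. Then for almost all $t\in[0,T]$ the following holds: if there exists an index $i$ such that $m_i(t)>m_j(t)$ for all $j\neq i$, then $u_i^*(t)=0$.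
   Context: Prime denotes transpose. A matrix is Metzler if its off-diagonal entries are nonnegative. $1_n\in\mathbb{R}^n$ is the all-ones column vector, $P:=I-\frac1n 1_n1_n'$, and $V(x):=\sum_{i=1}^n(x_i-\frac1n 1_n'x)^2=x'Px$. Throughout $r\ge 2$. $\mathcal{U}$ is the set of measurable functions $u:[0,T]\to\mathbb{R}^r$ with $u_i(t)\ge 0$ for $i=1,\dots,r$ and $\sum_{i=1}^r u_i(t)=1$ for all $t\in[0,T]$. For $u\in\mathcal{U}$, $x(t,u)$ is the solution at time $t$ of $\dot x=(\sum_i u_iA_i)x$, $x(0)=x_0$ (absolutely continuous, the equation holding for almost every $t$). A control $u^*\in\mathcal{U}$ is optimal if $V(x(T,u^* ))=\min_{u\in\mathcal{U}}V(x(T,u))$. *)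

(* Defs.v *)
From HB Require Import structures.
From mathcomp Require Import all_boot all_order all_algebra.
From mathcomp Require Import all_classical all_reals all_analysis.
From mathcomp Require Import measurable_realfun lebesgue_measure.
Set Implicit Arguments.
Unset Strict Implicit.
Unset Printing Implicit Defensive.
Import Order.TTheory GRing.Theory Num.Theory.
Import numFieldNormedType.Exports.
Local Open Scope classical_set_scope.
Local Open Scope ring_scope.

Definition metzler (R : realType) (n : nat) (A : 'M[R]_n) : Prop :=
  forall i j, i != j -> 0 <= A i j.

Definition zero_row_sums (R : realType) (n : nat) (A : 'M[R]_n) : Prop :=
  forall i, \sum_j A i j = 0.

Definition ones (R : realType) (n : nat) : 'cV[R]_n := const_mx 1.

Definition Pmx (R : realType) (n : nat) : 'M[R]_n :=
  1%:M - n%:R^-1 *: (ones R n *m (ones R n)^T).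

(* The objective V(x) = x' P x, with P = Pmx R n. *)
Definition disagreement (R : realType) (n : nat) (x : 'cV[R]_n) : R :=
  \sum_i (x i 0 - n%:R^-1 * ((ones R n)^T *m x) 0 0) ^+ 2.

(* The source carries the completed (Lebesgue) sigma-algebra; the default
   measurable structure on R is the Borel one. *)
Definition lebesgue_measurable_fun (R : realType) (D : set R) (f : R -> R) :
    Prop :=
  @measurable_fun _ _
    (g_sigma_algebraType (completed_algebra_gen (@lebesgue_measure R)))
    (measurableTypeR R) D f.

Definition absolutely_continuous (R : realType) (W : normedModType R) (a b : R)
    (f : R -> W) : Prop :=
  forall e : R, 0 < e -> exists2 d : R, 0 < d &
    forall (N : nat) (s t : 'I_N -> R),
      (forall k, a <= s k /\ s k <= t k /\ t k <= b) ->
      trivIset [set: 'I_N] (fun k => `]s k, t k[%classic) ->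
      \sum_(k < N) (t k - s k) < d ->
      \sum_(k < N) `|f (t k) - f (s k)| < e.

(* x' = M(t) x on [0, T] in the sense of Caratheodory. Functions on [0, T] are
   represented by functions on R whose values outside [0, T] play no role: the
   two-sided derivative sees them only at t = 0 and t = T, a null set. *)
Definition solves (R : realType) (n : nat) (T : R) (M : R -> 'M[R]_n)
    (x : R -> 'cV[R]_n) : Prop :=
  absolutely_continuous 0 T x /\
  \forall t \ae (@lebesgue_measure R),
    t \in `[0, T] -> is_derive t (1 : R) x (M t *m x t).

Definition admissible (R : realType) (r : nat) (T : R) (u : R -> 'cV[R]_r) :
    Prop :=
  (forall i, lebesgue_measurable_fun `[0, T]%classic (fun t => u t i 0)) /\
  forall t, t \in `[0, T] ->
    (forall i, 0 <= u t i 0) /\ \sum_i u t i 0 = 1.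

Definition mix (R : realType) (n r : nat) (A : 'I_r -> 'M[R]_n)
    (u : R -> 'cV[R]_r) (t : R) : 'M[R]_n :=
  \sum_(i < r) u t i 0 *: A i.

Definition trajectory (R : realType) (n r : nat) (A : 'I_r -> 'M[R]_n)
    (x0 : 'cV[R]_n) (T : R) (u : R -> 'cV[R]_r) (x : R -> 'cV[R]_n) : Prop :=
  solves T (mix A u) x /\ x 0 = x0.

(* As trajectories exist and are unique on [0, T], quantifying over x and y
   amounts to V(x(T, u)) <= V(x(T, v)). *)
Definition optimal (R : realType) (n r : nat) (A : 'I_r -> 'M[R]_n)
    (x0 : 'cV[R]_n) (T : R) (u : R -> 'cV[R]_r) : Prop :=
  admissible T u /\
  forall (v : R -> 'cV[R]_r) (x y : R -> 'cV[R]_n),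
    admissible T v -> trajectory A x0 T u x -> trajectory A x0 T v y ->
    disagreement (x T) <= disagreement (y T).

Definition adjoint (R : realType) (n r : nat) (A : 'I_r -> 'M[R]_n) (T : R)
    (u : R -> 'cV[R]_r) (x lam : R -> 'cV[R]_n) : Prop :=
  solves T (fun t => - (mix A u t)^T) lam /\ lam T = Pmx R n *m x T.

Definition switching (R : realType) (n r : nat) (A : 'I_r -> 'M[R]_n)
    (x lam : R -> 'cV[R]_n) (i : 'I_r) (t : R) : R :=
  ((lam t)^T *m A i *m x t) 0 0.

(* Main.v *)
(** The admissible controls form a convex set and the dynamics is affine in the
    control, so one can argue with a convex variation instead of needles. Fix
    [k != i], let [phi = max(0, m_i - m_k)], and transfer the amount
    [e * phi * u_i] of control from index [i] to index [k]. The new trajectory is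
    [x + D] with [D = O(e)], and [p = lam' D] satisfies
    [p' = - e * phi^2 * u_i + O(e^2)] almost everywhere. Since [lam T = P (x T)],
    optimality gives [0 <= 2 * p T + V (D T)] where [V (D T) = O(e^2)]; hence
    [e * \int phi^2 u_i <= O(e^2)] for all small [e], so that [phi^2 u_i]
    vanishes almost everywhere. Integrals enter only through primitives of
    bounded measurable functions; all estimates compare absolutely continuous
    functions by means of their derivatives almost everywhere. *)
Require Import Defs.
From HB Require Import structures.
From mathcomp Require Import all_boot all_order all_algebra.
From mathcomp Require Import all_classical all_reals all_analysis.
From mathcomp Require Import measurable_realfun lebesgue_measure.
From mathcomp Require Import ring lra.
Set Implicit Arguments.
Unset Strict Implicit.
Unset Printing Implicit Defensive.
Import Order.TTheory GRing.Theory Num.Theory.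
Import numFieldNormedType.Exports.
Local Open Scope classical_set_scope.
Local Open Scope ring_scope.

(** * Calculus of absolutely continuous functions on a compact interval *)

Section absolute_continuity.
Context {R : realType}.
Implicit Types (W : normedModType R) (a b : R).

Lemma absolutely_continuousS W a b a' b' (f : R -> W) : a <= a' -> b' <= b ->
  absolutely_continuous a b f -> absolutely_continuous a' b' f.
Proof.
move=> aa' bb' acf e /acf[d d0 fd]; exists d => // N s t st; apply: fd => k.
have [as_ [st_ tb]] := st k.
by split; [exact: le_trans as_|split => //; exact: le_trans tb _].
Qed.

(** The transfer principle from which Lipschitz functions, norms, coordinates, scalar multiples and
    later the positive part inherit absolute continuity. *)
Lemma absolutely_continuous_dominated W W' a b (C : R) (f : R -> W)
    (g : R -> W') :
  (forall s t, a <= s -> s <= t -> t <= b ->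
    `|g t - g s| <= C * `|f t - f s|) ->
  absolutely_continuous a b f -> absolutely_continuous a b g.
Proof.
move=> gf acf e e0.
(* This constant is positive whatever the sign of [C], so it can divide [e]. *)
have C0 : 0 < `|C| + 1 by rewrite ltr_wpDl.
have [d d0 fd] := acf (e / (`|C| + 1)) (divr_gt0 e0 C0).
exists d => // N s t st tr sd.
have := fd _ _ _ st tr sd; rewrite ltr_pdivlMr// => h.
apply: le_lt_trans h; rewrite mulr_suml; apply: ler_sum => k _.
have [as_ [st_ tb]] := st k.
rewrite (le_trans (gf _ _ as_ st_ tb))// mulrC ler_wpM2l//.
by rewrite (le_trans (ler_norm _))// lerDl.
Qed.

Lemma absolutely_continuousD W a b (f g : R -> W) :
  absolutely_continuous a b f -> absolutely_continuous a b g ->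
  absolutely_continuous a b (fun t => f t + g t).
Proof.
move=> acf acg e e0.
have e20 : 0 < e / 2 by rewrite divr_gt0.
have [d d0 fd] := acf _ e20; have [d' d'0 gd] := acg _ e20.
exists (Num.min d d'); first by rewrite lt_min d0.
move=> N s t st tr; rewrite lt_min => /andP[sd sd'].
rewrite [e]splitr (le_lt_trans _ (ltrD (fd _ _ _ st tr sd) (gd _ _ _ st tr sd')))//.
rewrite -big_split/=; apply: ler_sum => k _.
by rewrite opprD addrACA ler_normD.
Qed.

Lemma absolutely_continuous_lipschitz W a b (C : R) (f : R -> W) :
  (forall s t, a <= s -> s <= t -> t <= b -> `|f t - f s| <= C * (t - s)) ->
  absolutely_continuous a b f.
Proof.
move=> fC; apply: (@absolutely_continuous_dominated R W a b C (fun t => t)).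
  by move=> s t as_ st tb; rewrite ger0_norm ?subr_ge0//; exact: fC.
move=> e e0; exists e => // N s t st tr.
rewrite (eq_bigr (fun k => `|t k - s k|))// => k _.
by rewrite ger0_norm// subr_ge0; have [_ []] := st k.
Qed.

Lemma absolutely_continuous_uniform W a b (f : R -> W) :
  absolutely_continuous a b f -> forall e, 0 < e ->
  exists2 d, 0 < d & forall s t, a <= s <= b -> a <= t <= b ->
    `|t - s| < d -> `|f t - f s| < e.
Proof.
move=> acf e /acf[d d0 fd]; exists d => //.
have wlg s t : s <= t -> a <= s <= b -> a <= t <= b ->
    `|t - s| < d -> `|f t - f s| < e.
  move=> st /andP[as_ sb] /andP[at_ tb]; rewrite ger0_norm ?subr_ge0// => tsd.
  have := fd 1%N (fun=> s) (fun=> t) (fun=> conj as_ (conj st tb)).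
  by rewrite !big_ord1; apply => // i j; rewrite !ord1.
move=> s t sab tab; have [st|/ltW ts] := leP s t; first exact: wlg.
by rewrite distrC [X in _ -> X < _]distrC; exact: wlg.
Qed.

Lemma absolutely_continuous_within W a b (f : R -> W) :
  absolutely_continuous a b f -> {within `[a, b], continuous f}.
Proof.
move=> acf; apply/subspace_continuousP => t tab.
apply/cvgrPdist_lt => e e0.
have [d d0 fd] := absolutely_continuous_uniform acf e0.
rewrite near_withinE; apply/nbhs_ballP; exists d => // s /= std sab.
rewrite distrC; move: tab sab; rewrite /= !in_itv/= => tab sab.
by apply: fd => //; rewrite distrC.
Qed.

Lemma absolutely_continuous_bounded W a b (f : R -> W) : a <= b ->
  absolutely_continuous a b f ->
  exists2 C, 0 <= C & forall t, t \in `[a, b] -> `|f t| <= C.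
Proof.
move=> ab acf; have acn : absolutely_continuous a b (fun t => `|f t|).
  apply: (absolutely_continuous_dominated (C := 1)) acf => s t _ _ _.
  by rewrite mul1r; exact: ler_dist_dist.
have [c cab fc] := EVT_max ab (absolutely_continuous_within acn).
by exists `|f c|.
Qed.

(** Both factors are bounded on the compact interval, so an increment of the product is at most [C]
    times one of [g] plus [D] times one of [f]. *)
Lemma absolutely_continuousM a b (f g : R -> R) : a <= b ->
  absolutely_continuous a b f -> absolutely_continuous a b g ->
  absolutely_continuous a b (fun t => f t * g t).
Proof.
move=> ab acf acg.
have [C C0 fC] := absolutely_continuous_bounded ab acf.
have [D D0 gD] := absolutely_continuous_bounded ab acg.
move=> e e0; have CD0 : 0 < C + D + 1 by rewrite ltr_wpDl// addr_ge0.
have e'0 := divr_gt0 e0 CD0.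
have [d d0 fd] := acf _ e'0; have [d' d'0 gd] := acg _ e'0.
exists (Num.min d d'); first by rewrite lt_min d0.
move=> N s t st tr; rewrite lt_min => /andP[sd sd'].
have h1 := ltW (fd _ _ _ st tr sd); have h2 := ltW (gd _ _ _ st tr sd').
apply: (@le_lt_trans _ _ (C * (e / (C + D + 1)) + D * (e / (C + D + 1)))).
  apply: le_trans (lerD (ler_wpM2l C0 h2) (ler_wpM2l D0 h1)).
  rewrite !mulr_sumr -big_split/=; apply: ler_sum => k _.
  have [as_ [st_ tb]] := st k.
  have -> : f (t k) * g (t k) - f (s k) * g (s k) =
    f (t k) * (g (t k) - g (s k)) + g (s k) * (f (t k) - f (s k)) by ring.
  rewrite (le_trans (ler_normD _ _))// !normrM lerD// ler_wpM2r//.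
    by apply: fC; rewrite in_itv/= tb (le_trans as_).
  by apply: gD; rewrite in_itv/= as_ (le_trans st_).
rewrite -mulrDl mulrCA gtr_pMr// ltr_pdivrMr// mul1r; lra.
Qed.

Lemma absolutely_continuous_cst W a b (c : W) :
  absolutely_continuous a b (fun=> c).
Proof.
apply: (@absolutely_continuous_lipschitz _ _ _ 0) => s t _ _ _.
by rewrite subrr normr0 mul0r.
Qed.

Lemma absolutely_continuousZ a b (c : R) (f : R -> R) :
  absolutely_continuous a b f -> absolutely_continuous a b (fun t => c * f t).
Proof.
apply: (absolutely_continuous_dominated (C := `|c|)) => s t _ _ _.
by rewrite -mulrBr normrM.
Qed.

Lemma absolutely_continuousN a b (f : R -> R) :
  absolutely_continuous a b f -> absolutely_continuous a b (fun t => - f t).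
Proof.
apply: (absolutely_continuous_dominated (C := 1)) => s t _ _ _.
by rewrite -opprD normrN mul1r.
Qed.

Lemma absolutely_continuous_sum W a b n (f : 'I_n -> R -> W) :
  (forall i, absolutely_continuous a b (f i)) ->
  absolutely_continuous a b (fun t => \sum_i f i t).
Proof.
move=> acf; elim: n f acf => [|n IHn] f acf.
  have -> : (fun t => \sum_(i < 0) f i t) = (fun=> 0).
    by apply/funext => t; rewrite big_ord0.
  exact: absolutely_continuous_cst.
have -> : (fun t => \sum_(i < n.+1) f i t) =
    (fun t => f ord0 t + \sum_(i < n) f (lift ord0 i) t).
  by apply/funext => t; rewrite big_ord_recl.
apply: absolutely_continuousD; first exact: acf.
exact: (IHn (fun i => f (lift ord0 i))).
Qed.

Lemma norm_coord_le m n (M : 'M[R]_(m, n)) i j : `|M i j| <= `|M|.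
Proof.
rewrite [leRHS]/Num.Def.normr/= mx_normrE.
exact: (le_bigmax _ (fun ij : 'I_m * 'I_n => `|M ij.1 ij.2|) (i, j)).
Qed.

Lemma absolutely_continuous_coord a b n (f : R -> 'cV[R]_n) i :
  absolutely_continuous a b f -> absolutely_continuous a b (fun t => f t i 0).
Proof.
apply: (absolutely_continuous_dominated (C := 1)) => s t _ _ _.
by rewrite mul1r (le_trans _ (norm_coord_le _ i 0))// !mxE.
Qed.

Lemma absolutely_continuous_expR (K b : R) : 0 <= K ->
  absolutely_continuous 0 b (fun t => expR (K * t)).
Proof.
move=> K0; apply: (@absolutely_continuous_lipschitz _ _ _ (expR (K * b) * K)).
move=> s t s0 st tb.
rewrite ger0_norm; last by rewrite subr_ge0 ler_expR ler_wpM2l.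
apply: (@le_trans _ _ (expR (K * t) * (K * (t - s)))).
  (* With the larger exponential factored out, the bound [1 - expR (- h) <= h] does the work of the
     mean value theorem. *)
  have -> : expR (K * s) = expR (K * t) * expR (- (K * (t - s))).
    by rewrite -expRD; congr expR; ring.
  have := expR_ge1Dx (- (K * (t - s))) => h.
  rewrite -{1}[expR (K * t)]mulr1 -mulrBr ler_wpM2l ?expR_ge0//; lra.
rewrite -mulrA ler_wpM2r ?mulr_ge0 ?subr_ge0// ler_expR ler_wpM2l//.
Qed.

End absolute_continuity.

(** * Comparison of absolutely continuous functions through their derivatives almost everywhere *)

Section monotonicity.
Context {R : realType}.
Notation mu := (@lebesgue_measure R).

#[export] Instance lebesgue_ae_filter : Filter (almost_everywhere mu).
Proof. exact: ae_filter_ringOfSetsType. Qed.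

(* The list stores the intervals from right to left. *)
Definition interval_chain (U : set R) (a t : R) (l : seq (R * R)) : Prop :=
  (forall p, p \in l ->
    [/\ a <= p.1, p.1 <= p.2, p.2 <= t & `]p.1, p.2[%classic `<=` U]) /\
  pairwise (fun p q : R * R => q.2 <= p.1) l.

Lemma interval_chain_cons U a s t l : a <= s -> s <= t ->
  `]s, t[%classic `<=` U -> interval_chain U a s l ->
  interval_chain U a t ((s, t) :: l).
Proof.
move=> as_ st stU [lU pl]; split => [p|].
  rewrite inE => /orP[/eqP->//|/lU[ap pp ps pU]].
  by split => //; exact: le_trans st.
by rewrite /= pl andbT; apply/allP => p /lU[].
Qed.

Lemma interval_chainW U a s t l : s <= t ->
  interval_chain U a s l -> interval_chain U a t l.
Proof.
move=> st [lU pl]; split => // p /lU[ap pp ps pU].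
by split => //; exact: le_trans st.
Qed.

Lemma interval_chain_trivIset U a t l : interval_chain U a t l ->
  trivIset [set: 'I_(size l)]
    (fun k => `](nth (0, 0) l k).1, (nth (0, 0) l k).2[%classic).
Proof.
move=> [lU /(pairwiseP (0, 0)) pl]; apply/trivIsetP.
have disj (i j : 'I_(size l)) : (i < j)%N ->
    `](nth (0, 0) l i).1, (nth (0, 0) l i).2[%classic `&`
    `](nth (0, 0) l j).1, (nth (0, 0) l j).2[%classic = set0.
  move=> ij; have ji := pl i j (ltn_ord i) (ltn_ord j) ij.
  apply/seteqP; split => // x [] /=; rewrite !in_itv/= => /andP[ix _] /andP[_ xj].
  by have := lt_trans (le_lt_trans ji ix) xj; rewrite ltxx.
move=> i j _ _; rewrite neq_ltn => /orP[|] ij; first exact: disj.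
by rewrite setIC disj.
Qed.

(** The intervals are disjoint and contained in [U], so additivity and monotonicity of the measure
    apply. *)
Lemma interval_chain_measure U a t l : measurable U -> interval_chain U a t l ->
  ((\sum_(k < size l) ((nth (0, 0) l k).2 - (nth (0, 0) l k).1))%:E <= mu U)%E.
Proof.
move=> mU lUt; have tl := interval_chain_trivIset lUt.
have [lU _] := lUt.
have lk (k : 'I_(size l)) := lU _ (mem_nth (0, 0) (ltn_ord k)).
rewrite -sumEFin (eq_bigr (fun k : 'I_(size l) =>
    mu `](nth (0, 0) l k).1, (nth (0, 0) l k).2[%classic)); last first.
  move=> k _; have [_ kk _ _] := lk k.
  rewrite lebesgue_measure_itv/= lte_fin; case: ltP => // kk'.
  by congr EFin; apply/eqP; rewrite subr_eq0 eq_le kk kk'.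
rewrite -(measure_bigsetU_ord _ xpredT)//.
apply: le_measure; rewrite ?inE//; first exact: bigsetU_measurable.
elim/big_ind: _ => [//|V W VU WU|k _]; first by rewrite subUset.
by have [] := lk k.
Qed.


(** Continuous induction: call [t] good if the claim holds on [[a, t]]. A good point just left of
    the supremum [c] of the good points is joined to points at or beyond [c] by the local hypothesis
    at [c]. The joining interval either enters the chain or has its increment paid for by the slope
    [e]. *)
Lemma interval_chain_increment (f : R -> R) a b (e : R) U : a <= b -> 0 <= e ->
  (forall c, a <= c <= b -> exists2 d, 0 < d &
    forall s t, a <= s -> s <= c -> c <= t -> t <= b ->
      c - d < s -> t < c + d ->
      `]s, t[%classic `<=` U \/ f t - f s <= e * (t - s)) ->
  exists2 l, interval_chain U a b l &
    f b - f a <= \sum_(p <- l) (f p.2 - f p.1) + e * (b - a).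
Proof.
move=> ab e0 loc.
pose good t := exists2 l, interval_chain U a t l &
    f t - f a <= \sum_(p <- l) (f p.2 - f p.1) + e * (t - a).
pose G := [set t | a <= t <= b /\ good t].
have Ga : G a.
  split; first by rewrite lexx.
  by exists [::] => //; rewrite big_nil !subrr mulr0 addr0.
have Gb : has_sup G by split; [exists a|exists b => t [/andP[]]].
have ac : a <= sup G by exact: (ub_le_sup Gb.2 Ga).
have cb : sup G <= b by apply: ge_sup => [|t [/andP[]]//]; exists a.
have [d d0 locd] := loc (sup G) (introT andP (conj ac cb)).
have [s [/andP[as_ sb] [l lU fl]] cds] := sup_adherent d0 Gb.
have sc : s <= sup G by apply: (ub_le_sup Gb.2); split; [rewrite as_|exists l].
have step t : sup G <= t -> t <= b -> t < sup G + d -> good t.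
  move=> ct tb tcd; have st := le_trans sc ct.
  case: (locd s t) => // [stU|fst].
    exists ((s, t) :: l); first exact: interval_chain_cons lU.
    rewrite big_cons/=; have := mulr_ge0 e0 (_ : 0 <= t - s); rewrite subr_ge0 => /(_ st).
    by move: fl; lra.
  exists l; first exact: interval_chainW lU.
  by move: fl fst; lra.
(* If the supremum is [b], then [b] itself is good; otherwise a good point beyond the supremum gives
   a contradiction. *)
have [bc|cb'] := leP b (sup G).
  by apply: step => //; lra.
pose t := Num.min b (sup G + d / 2).
have ct : sup G < t by rewrite lt_min cb' ltrDl divr_gt0.
have tb : t <= b by rewrite ge_min lexx.
have Gt : G t.
  split; first by rewrite tb andbT (le_trans ac)// ltW.
  apply: step => //; first exact: ltW.
  by rewrite gt_min ltrD2l ltr_pdivrMr// ltr_pMr// ltr1n orbT.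
have : t <= sup G by exact: (ub_le_sup Gb.2 Gt).
by rewrite leNgt ct.
Qed.

(** The straddle lemma: the difference quotients at [c] are close to [v] on either side, and the
    bounds over [[s, c]] and [[c, t]] add up. *)
Lemma is_derive_straddle (f : R -> R) (c v e : R) : 0 < e ->
  is_derive c (1 : R) f v -> exists2 d, 0 < d &
  forall s t, s <= c -> c <= t -> c - d < s -> t < c + d ->
    f t - f s <= (v + e) * (t - s).
Proof.
move=> e0 fv; have [dfc fvE] := fv.
have : (fun h : R => h^-1 *: (f (h *: (1 : R) + c) - f c)) @ 0^' --> 'D_1 f c.
  exact: dfc.
move=> /cvgrPdist_lt/(_ _ e0); rewrite near_withinE => /nbhs_ballP[d /= d0 fd].
have {}fd (h : R) : h != 0 -> `|h| < d -> `|v - h^-1 * (f (c + h) - f c)| < e.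
  move=> h0 hd; have := fd h; rewrite /ball/= sub0r normrN => /(_ hd h0).
  by rewrite [h *: 1]mulr1 [h + c]addrC fvE.
exists d => // s t sc ct cds tcd.
suff [h1 h2] : f t - f c <= (v + e) * (t - c) /\ f c - f s <= (v + e) * (c - s).
  by lra.
split.
  have [->|tc] := eqVneq t c; first by rewrite !subrr mulr0.
  have tc0 : 0 < t - c by rewrite subr_gt0 lt_neqAle eq_sym tc.
  have := fd (t - c); rewrite gt_eqF// gtr0_norm// => /(_ isT).
  rewrite ltrBlDl => /(_ tcd); rewrite subrKC ltr_norml => /andP[h _].
  by rewrite -ler_pdivrMr// mulrC; lra.
have [->|tc] := eqVneq s c; first by rewrite !subrr mulr0.
have tc0 : 0 < c - s by rewrite subr_gt0 lt_neqAle tc.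
have sc0 : s - c < 0 by rewrite -oppr_gt0 opprB.
have := fd (s - c); rewrite lt_eqF// [`|s - c|]distrC gtr0_norm//.
move=> /(_ isT); rewrite ltrBlDl -ltrBlDr => /(_ cds).
rewrite subrKC ltr_norml => /andP[+ _].
rewrite -[s - c]opprB -[f s - f c]opprB invrN mulrNN => h.
by rewrite -ler_pdivrMr// mulrC; lra.
Qed.

(* The exceptional null set lies in an open set [U] of small measure: off [U] the
   derivative controls the increments of [f], and the intervals inside [U]
   contribute little by absolute continuity. *)
Theorem absolutely_continuous_nonincreasing (f : R -> R) a b : a <= b ->
  absolutely_continuous a b f ->
  (\forall t \ae mu, t \in `[a, b] ->
    exists2 v, is_derive t (1 : R) f v & v <= 0) ->
  f b <= f a.
Proof.
move=> ab acf [N [mN N0 Nf]].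
apply/ler_addgt0Pl => e e0.
(* The error [e] is spent as [e1] on the chain inside [U] and [e1 * (b - a)] on the slopes
   elsewhere. *)
pose e1 := e / (1 + (b - a)).
have ba1 : 0 < 1 + (b - a) by rewrite ltr_pwDl// subr_ge0.
have e10 : 0 < e1 by rewrite divr_gt0.
have [d d0 fd] := acf _ e10.
have [|U [oU NU Ud]] := @lebesgue_regularity_outer R N d mN _ d0.
  by rewrite -[X in (X < _)%E]/(mu N) [X in (X < _)%E]N0.
have mU : measurable U by exact: open_measurable.
(* Regularity bounds the measure of [U] minus [N]; adding back the null set [N] keeps the bound. *)
have {}Ud : (mu U < d%:E)%E.
  rewrite -(setDUK NU) (le_lt_trans (measureU2 _ _ _))//; first exact: measurableD.
  by rewrite -[X in (X + _)%E]/(mu N) [X in (X + _)%E]N0 add0e.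
have [|l lU fl] := @interval_chain_increment f a b e1 U ab (ltW e10).
  move=> c cab; have [Nc|Nc] := pselect (N c).
    have /nbhs_ballP[r /= r0 rU] := open_nbhs_nbhs (conj oU (NU _ Nc)).
    exists r => // s t _ _ _ _ crs tcr; left => x /=; rewrite in_itv/= => /andP[sx xt].
    apply: rU; rewrite /ball/= ltr_norml; lra.
  have [v fv v0] : exists2 v, is_derive c (1 : R) f v & v <= 0.
    by apply: contrapT => h; apply: Nc; apply: Nf => /=; rewrite in_itv/= cab => /(_ isT).
  have [r r0 fr] := is_derive_straddle e10 fv.
  exists r => // s t _ sc ct _ crs tcr; right; apply: (le_trans (fr s t _ _ _ _)) => //.
  by rewrite ler_wpM2r ?subr_ge0 ?(le_trans sc)// gerDr.
have lk (k : 'I_(size l)) := lU.1 _ (mem_nth (0, 0) (ltn_ord k)).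
have : \sum_(p <- l) (f p.2 - f p.1) <= e1.
  apply/ltW; apply: le_lt_trans (fd (size l) (fun k => (nth (0, 0) l k).1)
    (fun k => (nth (0, 0) l k).2) _ _ _).
  - by rewrite (big_nth (0, 0)) big_mkord; apply: ler_sum => k _; exact: ler_norm.
  - by move=> k; have [? ? ? _] := lk k.
  - exact: interval_chain_trivIset lU.
  - by rewrite -lte_fin (le_lt_trans (interval_chain_measure mU lU)).
move=> sl; rewrite -lerBlDr (le_trans fl)//.
rewrite (le_trans (lerD sl (lexx _)))// -{1}[e1]mulr1 -mulrDr.
by rewrite mulrVK// unitfE gt_eqF.
Qed.

(** Monotonicity of [f - g]: a mean value inequality that takes the place of integrating
    derivatives. *)
Corollary absolutely_continuous_increment_le (f g : R -> R) a b : a <= b ->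
  absolutely_continuous a b f -> absolutely_continuous a b g ->
  (\forall t \ae mu, t \in `[a, b] -> exists v w,
    [/\ is_derive t (1 : R) f v, is_derive t (1 : R) g w & v <= w]) ->
  f b - f a <= g b - g a.
Proof.
move=> ab acf acg fg.
suff : f b - g b <= f a - g a by lra.
apply: (@absolutely_continuous_nonincreasing (fun t => f t - g t)) => //.
  by apply: absolutely_continuousD => //; exact: absolutely_continuousN.
apply: filterS fg => t /[apply] -[v [w [fv gw vw]]].
by exists (v - w); [exact: is_deriveB|rewrite subr_le0].
Qed.

Corollary absolutely_continuous_increment_norm_le (f g : R -> R) a b : a <= b ->
  absolutely_continuous a b f -> absolutely_continuous a b g ->
  (\forall t \ae mu, t \in `[a, b] -> exists v w,
    [/\ is_derive t (1 : R) f v, is_derive t (1 : R) g w & `|v| <= w]) ->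
  `|f b - f a| <= g b - g a.
Proof.
move=> ab acf acg fg; rewrite ler_norml lerNl; apply/andP; split.
  suff : - f b - - f a <= g b - g a by lra.
  apply: (absolutely_continuous_increment_le (f := fun t => - f t)) => //.
    exact: absolutely_continuousN.
  apply: filterS fg => t /[apply] -[v [w [fv gw vw]]].
  exists (- v), w; split => //; first exact: is_deriveN.
  by rewrite (le_trans _ vw)// -normrN ler_norm.
apply: absolutely_continuous_increment_le => //.
apply: filterS fg => t /[apply] -[v [w [fv gw vw]]].
by exists v, w; split => //; rewrite (le_trans _ vw)// ler_norm.
Qed.

End monotonicity.

(** * Primitives of bounded measurable functions *)

Lemma ae_neq {R : realType} (a : R) : \forall t \ae @lebesgue_measure R, t != a.
Proof.
exists [set a]; split; [exact: measurable_set1|exact: lebesgue_measure_set1|].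
by move=> t /= /negP/negPn/eqP.
Qed.

Section primitive.
Context {R : realType}.
Notation mu := (@lebesgue_measure R).
Variables (T : R).

(** Cutting [g] off outside [[0, T]] makes the integrand integrable on the whole line, where the
    fundamental theorem of calculus is applied. *)
Definition primitive (g : R -> R) (x : R) : R :=
  (\int[mu]_(t in `[0, x]) (g \_ `[0%R, T]) t)%R.

Lemma primitive0 g : primitive g 0 = 0.
Proof. by rewrite /primitive set_itv1 Rintegral_set1. Qed.

Variables (C : R) (g : R -> R).
Hypothesis mg : measurable_fun `[0, T]%classic g.
Hypothesis gC : forall t, t \in `[0, T] -> `|g t| <= C.

Let g0 := g \_ `[0%R, T].

Let integrable_g0 : mu.-integrable setT (EFin \o g0).
Proof.
rewrite -restrict_EFin -integrable_mkcond//.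
apply: measurable_bounded_integrable => //.
  by rewrite /= lebesgue_measure_itv/=; case: ifP => // _; rewrite -EFinD ltry.
exists C; split; first exact: num_real.
by move=> M CM t /= t0T; rewrite (le_trans (gC _))// ltW.
Qed.

Lemma primitive_absolutely_continuous : absolutely_continuous 0 T (primitive g).
Proof.
apply: (@absolutely_continuous_lipschitz _ _ _ _ C) => s t s0 st tT.
have ist : mu.-integrable `]s, t] (EFin \o g0) by exact: integrableS integrable_g0.
rewrite Rintegral_itvB ?bnd_simp//; last exact: integrableS integrable_g0.
apply: le_trans (le_normr_Rintegral _ _) _ => //.
apply: (@le_trans _ _ (\int[mu]_(x in `]s, t]) C)%R).
  apply: le_Rintegral => //.
  - exact: integrable_norm.
  - apply: measurable_bounded_integrable => //.
      by rewrite /= lebesgue_measure_itv/=; case: ifP => // _; rewrite -EFinD ltry.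
    exists `|C|; split; first exact: num_real.
    by move=> M CM x _ /=; exact: ltW.
  - move=> x /=; rewrite in_itv/= => /andP[sx xt].
    have x0T : x \in `[0, T].
      by rewrite in_itv/= (le_trans xt)// andbT (le_trans s0)// ltW.
    by rewrite /g0 patchE mem_set// gC.
rewrite Rintegral_cst//= lebesgue_measure_itv/= lte_fin; case: ltP => //= ts.
by rewrite mulr0 (_ : t = s) ?subrr ?mulr0//; apply/eqP; rewrite eq_le ts.
Qed.

Lemma primitive_is_derive :
  \forall t \ae mu, t \in `[0, T] -> is_derive t (1 : R) (primitive g) (g t).
Proof.
have lg0 : locally_integrable setT g0.
  exact: open_integrable_locally openT integrable_g0.
have ig0 y : mu.-integrable `[0, y] (EFin \o g0).
 exact: integrableS integrable_g0.
(* [FTC1] concerns points strictly right of the lower limit, so [0] joins the exceptional set. *)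
apply: filterS2 (ae_neq 0) (FTC1 ig0 lg0) => t t_neq0 /= dF.
rewrite in_itv/= => t0T; have /andP[t0 tT] := t0T.
have [|dt dg] := dF; first by rewrite lte_fin lt_neqAle eq_sym t_neq0.
split; first exact: dt.
by rewrite -derive1E dg /g0 patchE mem_set//= in_itv.
Qed.

End primitive.

(** * Linear differential equations with measurable coefficients, by Picard iteration *)

(** The intervals of radius [2 * B * 2^-1 ^+ k] around [u k] are nested, so the supremum of their
    left ends lies in all of them. *)
Lemma geometric_limit {R : realType} (u : nat -> R) (B : R) :
  (forall k, `|u k.+1 - u k| <= B * 2^-1 ^+ k) ->
  exists l, forall k, `|u k - l| <= 2 * B * 2^-1 ^+ k.
Proof.
move=> uB; have B0 : 0 <= B.
  by have := le_trans (normr_ge0 _) (uB 0%N); rewrite expr0 mulr1.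
have p0 k : 0 <= 2^-1 ^+ k :> R by rewrite exprn_ge0.
pose lo k := u k - 2 * B * 2^-1 ^+ k; pose hi k := u k + 2 * B * 2^-1 ^+ k.
have nlo : {homo lo : m k / (m <= k)%N >-> m <= k}.
  apply: homo_leq => [x|x y z|k]; [exact: lexx|exact: le_trans|].
  rewrite /lo exprS; have := uB k; rewrite ler_norml; lra.
have nhi : {homo hi : m k / (m <= k)%N >-> k <= m}.
  apply: homo_leq => [x|x y z xy yz|k]; [exact: lexx|exact: le_trans yz xy|].
  rewrite /hi exprS; have := uB k; rewrite ler_norml; lra.
have lohi j k : lo j <= hi k.
  rewrite (le_trans (nlo _ _ (leq_maxl j k)))//.
  rewrite (le_trans _ (nhi _ _ (leq_maxr j k)))// /lo /hi.
  have := mulr_ge0 B0 (p0 (maxn j k)); lra.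
exists (sup (range lo)) => k; rewrite ler_distlC.
have lk : lo k <= sup (range lo).
  by apply: ub_le_sup; [exists (hi k) => _ [j _ <-]|exists k].
have hk : sup (range lo) <= hi k.
  by apply: ge_sup; [exists (lo 0%N), 0%N|move=> _ [j _ <-]].
by move: lk hk; rewrite /lo /hi; lra.
Qed.

Lemma cvg_geometric_bound {R : realType} (u : nat -> R) (l C : R) :
  (forall k, `|u k - l| <= C * 2^-1 ^+ k) -> u k @[k --> \oo] --> l.
Proof.
move=> ul.
have h : C * 2^-1 ^+ k @[k --> \oo] --> C * 0.
  by apply: cvgMl_tmp; apply: cvg_expr; rewrite ger0_norm ?invf_lt1 ?ltr1n.
rewrite mulr0 in h; move/cvgr0Pnorm_le : h => h; apply/cvgrPdist_le => e /h.
apply: filterS => k; apply: le_trans; rewrite distrC.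
exact: le_trans (ul k) (ler_norm _).
Qed.

Section linear_ode.
Context {R : realType}.
Notation mu := (@lebesgue_measure R).
Variables (n : nat) (T : R) (M : 'I_n -> 'I_n -> R -> R) (b : 'I_n -> R -> R).
Variables (L eta : R).
Hypotheses (T0 : 0 <= T) (L0 : 0 <= L).
Hypotheses (mM : forall i j, measurable_fun `[0, T]%classic (M i j))
  (mb : forall i, measurable_fun `[0, T]%classic (b i)).
Hypotheses (ML : forall i j t, t \in `[0, T] -> `|M i j t| <= L)
  (beta : forall i t, t \in `[0, T] -> `|b i t| <= eta).

Let rhs (d : 'I_n -> R -> R) i t := \sum_j M i j t * d j t + b i t.
Let picard (d : 'I_n -> R -> R) i := primitive T (rhs d i).
Let d_ k := iter k picard (fun _ _ => 0).

(* The Picard map halves distances in the norm sup_t e^(-K t) |d t|. *)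
Let K := 2 * (n%:R * L) + 1.

(** A class stable under [picard] and under the limit of the iterates, on which the results about
    primitives apply. *)
Let ok (d : 'I_n -> R -> R) := forall i, measurable_fun `[0, T]%classic (d i) /\
  exists C, forall t, t \in `[0, T] -> `|d i t| <= C.

Let ok_rhs d i : ok d -> measurable_fun `[0, T]%classic (rhs d i) /\
  exists C, forall t, t \in `[0, T] -> `|rhs d i t| <= C.
Proof.
move=> dok; split.
  apply: measurable_funD => //; apply: measurable_sum => j.
  by apply: measurable_funM => //; exact: (dok j).1.
have /choice[C dC] := fun j => (dok j).2.
exists (\sum_j (L * C j) + eta) => t t0T; rewrite (le_trans (ler_normD _ _))//.
rewrite lerD ?beta// (le_trans (ler_norm_sum _ _ _))// ler_sum// => j _.
by rewrite normrM ler_pM ?ML ?dC.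
Qed.

Let picard_ac d i : ok d -> absolutely_continuous 0 T (picard d i).
Proof.
by move=> /(ok_rhs i)[mr [C rC]]; exact: primitive_absolutely_continuous rC.
Qed.

Let picard_derive d i : ok d -> \forall t \ae mu, t \in `[0, T] ->
  is_derive t (1 : R) (picard d i) (rhs d i t).
Proof. by move=> /(ok_rhs i)[mr [C rC]]; exact: primitive_is_derive rC. Qed.

Let picard_ok d : ok d -> ok (picard d).
Proof.
move=> dok i; have acp := picard_ac i dok; split.
  apply: subspace_continuous_measurable_fun => //.
  exact: absolutely_continuous_within.
by have [C _ pC] := absolutely_continuous_bounded T0 acp; exists C.
Qed.

Let K0 : 0 < K.
Proof. by rewrite ltr_wpDl// !mulr_ge0. Qed.

Let is_derive_weight (B t : R) :
  is_derive t (1 : R) (fun s => B * expR (K * s)) (B * (K * expR (K * t))).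
Proof.
have dK : is_derive t (1 : R) (fun s => K * s) K.
  have := is_deriveZ K (is_derive_id t (1 : R)).
  by rewrite [K *: 1]mulr1.
have := is_deriveZ B (is_derive1_comp (is_derive_expR (K * t)) dK).
by rewrite [expR _ * K]mulrC.
Qed.

Let ac_weight (B t : R) : absolutely_continuous 0 t (fun s => B * expR (K * s)).
Proof. by apply/absolutely_continuousZ/absolutely_continuous_expR/ltW. Qed.

(** The assumed bound is the derivative of [B * expR (K * t)]; comparing increments from [0] even
    leaves [B] to spare. *)
Let le_weight (f : R -> R) (B : R) : 0 <= B -> absolutely_continuous 0 T f ->
  f 0 = 0 ->
  (\forall t \ae mu, t \in `[0, T] -> exists2 v, is_derive t (1 : R) f v &
    `|v| <= B * (K * expR (K * t))) ->
  forall t, t \in `[0, T] -> `|f t| <= B * expR (K * t).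
Proof.
move=> B0 acf f0 df t; rewrite in_itv/= => /andP[t0 tT].
have := @absolutely_continuous_increment_norm_le _ f (fun s => B * expR (K * s))
  0 t t0.
rewrite f0 subr0 mulr0 expR0 mulr1 => h.
apply: (@le_trans _ _ (B * expR (K * t) - B)); last by rewrite gerBl.
apply: h => //; first exact: absolutely_continuousS acf.
apply: filterS df => s df; rewrite in_itv/= => /andP[s0 st].
have [|v fv vB] := df; first by rewrite in_itv/= s0 (le_trans st).
exists v, (B * (K * expR (K * s))); split => //; exact: is_derive_weight.
Qed.

(** The term [b] cancels, and the derivative of the difference is at most
    [n * L * B * expR (K * t)]. As [n * L <= K / 2], [le_weight] applies with [B / 2]. *)
Let picard_contraction d d' (B : R) : ok d -> ok d' -> 0 <= B ->
  (forall j t, t \in `[0, T] -> `|d j t - d' j t| <= B * expR (K * t)) ->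
  forall i t, t \in `[0, T] ->
    `|picard d i t - picard d' i t| <= B / 2 * expR (K * t).
Proof.
move=> dok dok' B0 dd' i.
apply: (le_weight (f := fun t => picard d i t - picard d' i t)).
- by rewrite divr_ge0.
- apply: absolutely_continuousD; first exact: picard_ac.
  by apply: absolutely_continuousN; exact: picard_ac.
- by rewrite /picard !primitive0 subrr.
apply: filterS2 (picard_derive i dok) (picard_derive i dok') => t dt dt' t0T.
exists (rhs d i t - rhs d' i t); first by apply: is_deriveB; [exact: dt|exact: dt'].
have -> : rhs d i t - rhs d' i t = \sum_j M i j t * (d j t - d' j t).
  rewrite /rhs opprD addrACA subrr addr0 -sumrB.
  by apply: eq_bigr => j _; rewrite mulrBr.
rewrite (le_trans (ler_norm_sum _ _ _))//.
apply: (@le_trans _ _ (\sum_(j < n) L * (B * expR (K * t)))).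
  by apply: ler_sum => j _; rewrite normrM ler_pM ?ML ?dd'.
rewrite sumr_const card_ord -[leLHS]mulr_natl.
have BE : 0 <= B * expR (K * t) by rewrite mulr_ge0 ?expR_ge0.
rewrite (_ : n%:R * _ = n%:R * L * (B * expR (K * t))); last by ring.
rewrite (_ : _ / 2 * _ = (K / 2) * (B * expR (K * t))); last by ring.
by rewrite ler_wpM2r// /K; lra.
Qed.

(** The Picard iterates started at zero converge geometrically at each point of [[0, T]], and the
    contraction makes their limit a fixed point there. *)
Theorem linear_ode_solution : exists D : 'I_n -> R -> R,
  [/\ forall i, D i 0 = 0, forall i, absolutely_continuous 0 T (D i),
      forall i, \forall t \ae mu, t \in `[0, T] ->
        is_derive t (1 : R) (D i) (\sum_j M i j t * D j t + b i t) &
      forall i t, t \in `[0, T] -> `|D i t| <= 2 * eta * expR ((2 * (n%:R * L) + 1) * T)].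
Proof.
(* The sign of [eta] is read off from [b], which takes an index [i]; none exists when [n = 0]. *)
have eta0 (i : 'I_n) (t : R) : t \in `[0, T] -> 0 <= eta.
  by move=> t0T; exact: le_trans (normr_ge0 _) (beta i t0T).
have d_ok k : ok (d_ k).
  elim: k => [i|k]; last exact: picard_ok.
  by split; [exact: measurable_cst|exists 0 => t _; rewrite normr0].
have d_step k i t : t \in `[0, T] ->
    `|d_ k.+1 i t - d_ k i t| <= eta * expR (K * t) * 2^-1 ^+ k.
  move=> t0T; have e0 := eta0 i t t0T.
  suff : `|d_ k.+1 i t - d_ k i t| <= eta * 2^-1 ^+ k * expR (K * t).
    by rewrite mulrAC.
  elim: k i t t0T => [|k IHk] i t t0T.
    rewrite expr0 mulr1 subr0; move: t t0T.
    apply: le_weight => //; first exact: picard_ac (d_ok 0%N).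
      exact: primitive0.
    apply: filterS (picard_derive i (d_ok 0%N)) => t dt t0T.
    exists (rhs (d_ 0) i t); first exact: dt.
    rewrite /rhs big1 => [|j _]; last by rewrite mulr0.
    (* The summand [1] in [K] ensures [1 <= K * expR (K * t)], so that [eta] is below the derivative
       of the weight. *)
    rewrite add0r (le_trans (beta i t0T))// ler_peMr//.
    have t0 : 0 <= t by move: t0T; rewrite in_itv => /andP[].
    rewrite mulr_ege1//; last by rewrite -expR0 ler_expR mulr_ge0// ltW.
    by rewrite /K lerDr !mulr_ge0.
  rewrite exprSr mulrA; apply: picard_contraction => //.
  - exact: d_ok k.+1.
  - by rewrite mulr_ge0 ?exprn_ge0// (eta0 i t).
(* The membership is placed under the existential so that [choice] yields a total function; outside
   [[0, T]] the value is arbitrary. *)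
have dlim (p : 'I_n * R) : exists l, p.2 \in `[0, T] -> forall k,
    `|d_ k p.1 p.2 - l| <= 2 * (eta * expR (K * p.2)) * 2^-1 ^+ k.
  case: p => i t; have [t0T|t0T] := boolP (t \in `[0, T]).
    by have [l dl] := geometric_limit (fun k => d_step k i t t0T); exists l.
  by exists 0.
have [d dP] := choice dlim.
pose D i t := d (i, t).
have {}dP k i t : t \in `[0, T] ->
    `|d_ k i t - D i t| <= 2 * eta * 2^-1 ^+ k * expR (K * t).
  by move=> t0T; have := dP (i, t) t0T k; rewrite mulrA mulrAC.
(* This is the convergence rate at [k = 0], where the iterate is zero. *)
have DB i t : t \in `[0, T] -> `|D i t| <= 2 * eta * expR (K * T).
  move=> t0T; have := dP 0%N i t t0T; rewrite sub0r normrN expr0 mulr1 => /le_trans.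
  have e0 := eta0 i t t0T.
  apply; rewrite ler_wpM2l ?mulr_ge0// ler_expR ler_wpM2l ?(ltW K0)//.
  by move: t0T; rewrite in_itv => /andP[].
have Dok : ok D.
  move=> i; split; last by exists (2 * eta * expR (K * T)) => t; exact: DB.
  apply: (measurable_fun_cvg (h := fun k => d_ k i)) => [k|t t0T].
    exact: (d_ok k i).1.
  apply: (@cvg_geometric_bound _ _ _ (2 * eta * expR (K * t))) => k.
  by rewrite mulrAC dP.
(* Both sides are close to [d_ k.+1 i t]: one by the contraction applied to [d_ k] and [D], the
   other by the convergence rate. *)
have pD i t : t \in `[0, T] -> picard D i t = D i t.
  move=> t0T; have e0 := eta0 i t t0T.
  have pDd k : `|picard D i t - D i t| <= 2 * (eta * expR (K * t)) * 2^-1 ^+ k.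
    have := picard_contraction (d_ok k) Dok _ (fun j s => dP k j s) i t0T.
    rewrite mulr_ge0 ?mulr_ge0 ?exprn_ge0// => /(_ isT) h.
    have := ler_distD (d_ k.+1 i t) (picard D i t) (D i t) => /le_trans; apply.
    rewrite distrC (le_trans (lerD h (dP k.+1 i t t0T)))// exprS.
    by rewrite le_eqVlt; apply/orP; left; apply/eqP; field.
  apply: (@cvg_unique _ _ (picard D i t @[_ --> \oo])) => //; first exact: cvg_cst.
  exact: cvg_geometric_bound pDd.
(* The solution is taken to be [picard D], a primitive and hence differentiable almost everywhere;
   [D] is known to equal it only on [[0, T]]. *)
exists (picard D); split.
- by move=> i; exact: primitive0.
- by move=> i; exact: picard_ac.
- move=> i; apply: filterS (picard_derive i Dok) => t dt t0T.
  rewrite (_ : \sum_j _ + _ = rhs D i t); first exact: dt.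
  by rewrite /rhs; congr (_ + _); apply: eq_bigr => j _; rewrite pD.
- by move=> i t t0T; rewrite pD// DB.
Qed.

End linear_ode.

(** * Borel representatives of Lebesgue measurable controls *)

Section borel_representative.
Context {R : realType}.
Notation mu := (@lebesgue_measure R).

Lemma borel_completed (D : set R) : measurable D ->
  (completed_algebra_gen mu).-sigma.-measurable D.
Proof.
move=> mD; apply: sub_sigma_algebra; exists D => //.
by exists set0; [exact: negligible_set0|rewrite setU0].
Qed.

Lemma borel_lebesgue_measurable (D : set R) (f : R -> R) : measurable D ->
  measurable_fun D f -> lebesgue_measurable_fun D f.
Proof. by move=> mD mf _ Y mY; apply: borel_completed; exact: mf. Qed.

(** Each set where [f < q] is Borel up to a null set. Doing this for rational [q] only costs a
    countable union [N] of null sets, and rational levels determine all others. *)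
Lemma lebesgue_measurable_fun_borel (D : set R) (f : R -> R) : measurable D ->
  lebesgue_measurable_fun D f ->
  exists N, [/\ measurable N, mu N = 0%E & measurable_fun (D `\` N) f].
Proof.
move=> mD mf.
pose S (q : R) := D `&` f @^-1` `]-oo, q[%classic.
have mS q : exists AF : set R * set R, [/\ measurable AF.1, measurable AF.2,
    mu AF.2 = 0%E, AF.1 `<=` S q & S q `<=` AF.1 `|` AF.2].
  have : (completed_algebra_gen mu).-sigma.-measurable (S q).
    by apply: mf; [exact: borel_completed|exact: measurable_itv].
  rewrite g_sigma_completed_algebra_genE => -[A mA [Z [F [mF F0 ZF]] AZ]].
  exists (A, F); split => //=.
    by move=> t At; rewrite -AZ; left.
  by rewrite -AZ => t [|/ZF]; [left|right].
have [AF AFP] := choice mS.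
(* An enumeration of the rationals; codes of no rational are sent to [0], a harmless repetition. *)
pose q k : R := ratr (odflt 0 (unpickle k)).
pose N := \bigcup_k (AF (q k)).2.
have mN : measurable N by apply: bigcupT_measurable => k; have [] := AFP (q k).
exists N; split => //.
  apply: measure_negligible => //; apply: negligible_bigcup => k.
  have [_ mF F0 _ _] := AFP (q k); exists (AF (q k)).2; split => //.
move=> mDN; apply: (measurability _ (RGenInftyO.measurableE R)) => // _ [_ [x ->] <-].
rewrite (_ : _ `&` _ = \bigcup_k (if q k < x then (AF (q k)).1 `\` N else set0)).
  apply: bigcupT_measurable => k; case: ifP => // _.
  by apply: measurableD => //; have [] := AFP (q k).
apply/seteqP; split => t /=.
  move=> [[Dt Nt]]; rewrite in_itv/= => ftx.
  have [p ftp px] : exists2 p : rat, f t < ratr p & ratr p < x.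
    by have [p] := rat_in_itvoo ftx; rewrite in_itv/= => /andP[]; exists p.
  have qp : q (pickle p) = ratr p by rewrite /q pickleK.
  exists (pickle p) => //; rewrite qp px; split => //.
  have [_ _ _ _ /(_ t)[|//|Ft]] := AFP (ratr p).
    by split => //=; rewrite in_itv.
  by exfalso; apply: Nt; exists (pickle p); rewrite ?qp.
move=> [k _]; case: ifP => // qx [At Nt].
have [_ _ _ /(_ _ At)[Dt /=] fq _] := AFP (q k).
by split => //; move: fq; rewrite !in_itv/= => /lt_trans; exact.
Qed.

(** On a Borel null set the control is replaced by the vertex [delta_mx k0 0], so the simplex
    constraint still holds at every time. [linear_ode_solution] asks for such Borel coefficients. *)
Lemma borel_control (r : nat) (T : R) (u : R -> 'cV[R]_r) (k0 : 'I_r) :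
  admissible T u -> exists v : R -> 'cV[R]_r,
  [/\ forall i, measurable_fun `[0, T]%classic (fun t => v t i 0),
      forall t, t \in `[0, T] -> (forall i, 0 <= v t i 0) /\ \sum_i v t i 0 = 1 &
      \forall t \ae mu, t \in `[0, T] -> v t = u t].
Proof.
move=> [mu_ u1].
have mD : measurable `[0, T]%classic by exact: measurable_itv.
have [N NP] := choice (fun i => lebesgue_measurable_fun_borel mD (mu_ i)).
pose Z := \big[setU/set0]_i N i.
have mZ : measurable Z by apply: bigsetU_measurable => i _; have [] := NP i.
have Z0 : mu Z = 0%E.
  apply: measure_negligible => //; rewrite /Z.
  elim/big_ind: _ => [|V W|i _]; [exact: negligible_set0|exact: negligibleU|].
  by have [mN N0 _] := NP i; exists (N i); split.
exists (fun t => if t \in Z then delta_mx k0 0 else u t); split.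
- move=> i; rewrite -(setDUK (@subIsetr _ Z `[0, T]%classic)).
  rewrite measurable_funU; [|exact: measurableI|]; last first.
    by apply: measurableD => //; exact: measurableI.
  split.
    apply: (eq_measurable_fun (fun=> (delta_mx k0 0 : 'cV[R]_r) i 0)) => //.
    by move=> t /set_mem[Zt _]; rewrite mem_set.
  apply: (eq_measurable_fun (fun t => u t i 0)).
    move=> t /set_mem[t0T nZt]; rewrite ifF//; apply/negP => /set_mem Zt.
    by apply: nZt.
  have [mN _] := NP i; apply: measurable_funS.
    exact: measurableD.
  move=> t [t0T nZt]; split => // Nt; apply: nZt; split => //.
  by rewrite /Z (bigD1 i) //; left.
- move=> t t0T; case: ifPn => _; last exact: u1.
  split => [i|]; first by rewrite mxE ler0n.
  rewrite (bigD1 k0)//= big1 ?mxE ?eqxx ?addr0// => i ik.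
  by rewrite mxE (negPf ik).
- exists Z; split => // t /= /not_implyP[_]; case: ifPn => // /set_mem.
  by move=> ?; exact.
Qed.

End borel_representative.

(** * Entrywise bounds for matrix products *)

Section matrix_bounds.
Context {R : realType}.

(** The entrywise l1 norm, chosen because it dominates the entries and the absolute row sums
    alike. *)
Definition mx_sum_norm m n (M : 'M[R]_(m, n)) : R := \sum_i \sum_j `|M i j|.

Lemma mx_sum_norm_ge0 m n (M : 'M[R]_(m, n)) : 0 <= mx_sum_norm M.
Proof. by apply: sumr_ge0 => i _; exact: sumr_ge0. Qed.

Lemma row_sum_norm_le m n (M : 'M[R]_(m, n)) i :
  \sum_j `|M i j| <= mx_sum_norm M.
Proof.
rewrite /mx_sum_norm (bigD1 i)//= lerDl.
by apply: sumr_ge0 => k _; exact: sumr_ge0.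
Qed.

Lemma norm_entry_le m n (M : 'M[R]_(m, n)) i j : `|M i j| <= mx_sum_norm M.
Proof.
apply: le_trans (row_sum_norm_le M i).
by rewrite (bigD1 j)//= lerDl sumr_ge0.
Qed.

Lemma mulmx_cV_le m n (M : 'M[R]_(m, n)) (v : 'cV_n) (B : R) i : 0 <= B ->
  (forall j, `|v j 0| <= B) -> `|(M *m v) i 0| <= mx_sum_norm M * B.
Proof.
move=> B0 vB; rewrite mxE (le_trans (ler_norm_sum _ _ _))//.
apply: (@le_trans _ _ (\sum_j `|M i j| * B)).
  by apply: ler_sum => j _; rewrite normrM ler_wpM2l.
by rewrite -mulr_suml ler_wpM2r// row_sum_norm_le.
Qed.

Lemma dot_le n (p q : 'cV[R]_n) (P Q : R) : (forall j, `|p j 0| <= P) ->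
  (forall j, `|q j 0| <= Q) -> `|(p^T *m q) 0 0| <= n%:R * (P * Q).
Proof.
move=> pP qQ; rewrite mxE (le_trans (ler_norm_sum _ _ _))//.
rewrite [leRHS]mulr_natl -[n in _ *+ n]card_ord -sumr_const.
by apply: ler_sum => j _; rewrite mxE normrM ler_pM.
Qed.

End matrix_bounds.

(** * Expansion and size of the quadratic objective *)

Section disagreement.
Context {R : realType}.

Lemma Pmx_mulE n (x : 'cV[R]_n) i :
  (Pmx R n *m x) i 0 = x i 0 - n%:R^-1 * ((ones R n)^T *m x) 0 0.
Proof.
rewrite mulmxBl mul1mx -scalemxAl -mulmxA [_ *m x]mx11_scalar.
by rewrite mul_mx_scalar !mxE mulr1.
Qed.

(** The cross term is the product of the centred vectors [P x] and [P d]; as the entries of [P x]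
    sum to zero, [P d] may be replaced by [d]. *)
Lemma disagreementD n (x d : 'cV[R]_n) : (0 < n)%N ->
  disagreement (x + d) =
  disagreement x + 2 * ((Pmx R n *m x)^T *m d) 0 0 + disagreement d.
Proof.
move=> n0; have nn : n%:R != 0 :> R by rewrite pnatr_eq0 -lt0n.
pose s := ((ones R n)^T *m x) 0 0; pose s' := ((ones R n)^T *m d) 0 0.
have sum_ones (z : 'cV[R]_n) : ((ones R n)^T *m z) 0 0 = \sum_i z i 0.
  by rewrite mxE; apply: eq_bigr => i _; rewrite !mxE mul1r.
have centered : \sum_i (x i 0 - n%:R^-1 * s) = 0.
  rewrite sumrB sumr_const card_ord -[X in _ - X]mulr_natl mulrA mulfV// mul1r.
  by rewrite -sum_ones subrr.
have -> : ((Pmx R n *m x)^T *m d) 0 0 =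
    \sum_i (x i 0 - n%:R^-1 * s) * (d i 0 - n%:R^-1 * s').
  under [RHS]eq_bigr do rewrite mulrBr.
  rewrite sumrB -mulr_suml centered mul0r subr0 mxE.
  by apply: eq_bigr => i _; rewrite mxE Pmx_mulE.
rewrite /disagreement mulr_sumr -!big_split/=; apply: eq_bigr => i _.
have -> : ((ones R n)^T *m (x + d)) 0 0 = s + s' by rewrite mulmxDr [LHS]mxE.
by rewrite -/s -/s' [(x + d) i 0]mxE; ring.
Qed.

(** An entry and the mean are both at most [B] in absolute value, so each deviation is at most
    [2 * B]. *)
Lemma disagreement_le n (d : 'cV[R]_n) (B : R) : (0 < n)%N ->
  (forall i, `|d i 0| <= B) -> disagreement d <= n%:R * (2 * B) ^+ 2.
Proof.
move=> n0 dB.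
rewrite [leRHS]mulr_natl -[n in _ *+ n]card_ord -sumr_const.
apply: ler_sum => i _; rewrite -[leLHS]real_normK ?num_real// lerXn2r ?nnegrE//.
  by rewrite mulr_ge0// (le_trans _ (dB i)).
rewrite (_ : 2 * B = B + B); last by ring.
rewrite (le_trans (ler_normB _ _))// lerD// normrM normfV normr_nat.
rewrite ler_pdivrMl ?ltr0n//.
have := @dot_le R n (ones R n) d 1 B _ dB; rewrite mul1r; apply => j.
by rewrite mxE normr1.
Qed.

End disagreement.

(** * Regularity of the switching functions and solution of the perturbation equation *)

Section first_variation.
Context {R : realType}.
Notation mu := (@lebesgue_measure R).
Variables (n r : nat) (A : 'I_r -> 'M[R]_n) (x0 : 'cV[R]_n) (T : R).
Variables (u : R -> 'cV[R]_r) (x lam : R -> 'cV[R]_n).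
Hypotheses (n0 : (0 < n)%N) (T0 : 0 < T) (hopt : optimal A x0 T u)
  (hx : trajectory A x0 T u x) (hlam : adjoint A T u x lam).

Lemma is_derive_coord (f : R -> 'cV[R]_n) (v : 'cV[R]_n) t i :
  is_derive t (1 : R) f v -> is_derive t (1 : R) (fun s => f s i 0) (v i 0).
Proof.
move=> [df <-]; split; first exact: (derivable_mxP _ _ _).1.
by rewrite derive_mx// mxE.
Qed.

Lemma is_derive_col (f : 'I_n -> R -> R) (v : 'cV[R]_n) t :
  (forall i, is_derive t (1 : R) (f i) (v i 0)) ->
  is_derive t (1 : R) (fun s => \col_i f i s) v.
Proof.
move=> df; have dcol : derivable (fun s => \col_i f i s) t 1.
  apply/derivable_mxP => i j.
  rewrite (_ : (fun s => _) = f i); last by apply/funext => s; rewrite mxE.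
  by case: (df i).
split => //; rewrite derive_mx//; apply/colP => i; rewrite mxE.
rewrite (_ : (fun s => _) = f i); last by apply/funext => s; rewrite mxE.
by case: (df i).
Qed.

Lemma absolutely_continuous_col (f : 'I_n -> R -> R) :
  (forall i, absolutely_continuous 0 T (f i)) ->
  absolutely_continuous 0 T (fun s => \col_i f i s).
Proof.
move=> acf.
have -> : (fun s => \col_i f i s) =
    (fun s => \sum_i f i s *: (delta_mx i 0 : 'cV[R]_n)).
  apply/funext => s; apply/colP => i; rewrite mxE summxE (bigD1 i)//= big1.
    by rewrite !mxE !eqxx mulr1 addr0.
  by move=> j ji; rewrite !mxE eq_sym (negPf ji) mulr0.
apply: absolutely_continuous_sum => i.
apply: (absolutely_continuous_dominated (C := `|delta_mx i 0 : 'cV[R]_n|)) (acf i).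
by move=> s t _ _ _; rewrite -scalerBl normrZ mulrC.
Qed.

Lemma switching_ac l : absolutely_continuous 0 T (switching A x lam l).
Proof.
have acx j := absolutely_continuous_coord j hx.1.1.
have acl j := absolutely_continuous_coord j hlam.1.1.
have -> : switching A x lam l =
    (fun t => \sum_j (\sum_i lam t i 0 * A l i j) * x t j 0).
  apply/funext => t; rewrite /switching mxE; apply: eq_bigr => j _.
  by rewrite mxE; congr (_ * _); apply: eq_bigr => i _; rewrite mxE.
apply: absolutely_continuous_sum => j; apply: (absolutely_continuousM (ltW T0)) => //.
apply: absolutely_continuous_sum => i; apply: (absolutely_continuousM (ltW T0)) => //.
exact: absolutely_continuous_cst.
Qed.

(** [L] bounds the entries of every convex mixture of the [A l], and [E] is the resulting growth
    factor in [linear_ode_solution]. *)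
Let L := \sum_l mx_sum_norm (A l).
Let E := expR ((2 * (n%:R * L) + 1) * T).

Lemma mix_coord_le (v : R -> 'cV[R]_r) t i j :
  (forall l, 0 <= v t l 0) -> \sum_l v t l 0 = 1 -> `|mix A v t i j| <= L.
Proof.
move=> v0 v1; rewrite /mix summxE (le_trans (ler_norm_sum _ _ _))//.
apply: ler_sum => l _; rewrite mxE normrM -[leRHS]mul1r ler_pM ?norm_entry_le//.
by rewrite ger0_norm// -v1 (bigD1 l)//= lerDl sumr_ge0.
Qed.

(** Meant for the difference between the varied trajectory and [x], with [f] the extra drift along
    [x]. Solving for the difference gives its existence and its size at once. *)
Lemma perturbation (v : R -> 'cV[R]_r) (f : R -> 'cV[R]_n) (eta : R) :
  (forall l, measurable_fun `[0, T]%classic (fun t => v t l 0)) ->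
  (forall t, t \in `[0, T] -> (forall l, 0 <= v t l 0) /\ \sum_l v t l 0 = 1) ->
  (forall j, measurable_fun `[0, T]%classic (fun t => f t j 0)) ->
  (forall t j, t \in `[0, T] -> `|f t j 0| <= eta) ->
  exists D : R -> 'cV[R]_n, [/\ D 0 = 0, absolutely_continuous 0 T D,
    \forall t \ae mu, t \in `[0, T] ->
      is_derive t (1 : R) D (mix A v t *m D t + f t) &
    forall t j, t \in `[0, T] -> `|D t j 0| <= 2 * eta * E].
Proof.
move=> mv v1 mf feta.
have [|||||D [D0 acD dD DE]] := @linear_ode_solution R n T
    (fun i j t => mix A v t i j) (fun i t => f t i 0) L eta (ltW T0).
- by apply: sumr_ge0 => l _; exact: mx_sum_norm_ge0.
- move=> i j; rewrite /mix.
  have -> : (fun t => (\sum_(l < r) v t l 0 *: A l) i j) =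
      (fun t => \sum_(l < r) v t l 0 * A l i j).
    by apply/funext => t; rewrite summxE; apply: eq_bigr => l _; rewrite mxE.
  apply: measurable_sum => l; apply: measurable_funM => //.
- by [].
- by move=> i j t t0T; have [v0 v1'] := v1 t t0T; exact: mix_coord_le.
- by move=> i t t0T; exact: feta.
exists (fun t => \col_i D i t); split.
- by apply/colP => i; rewrite !mxE.
- exact: absolutely_continuous_col.
- have dD' : \forall t \ae mu, forall i : 'I_n, t \in `[0, T] ->
      is_derive t (1 : R) (D i) (\sum_j mix A v t i j * D j t + f t i 0).
    exact: filter_forall.
  apply: filterS dD' => t dDt t0T; apply: is_derive_col => i.
  rewrite !mxE (_ : \sum_j _ = \sum_j mix A v t i j * D j t); first exact: dDt.
  by apply: eq_bigr => j _; rewrite mxE.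
- by move=> t j t0T; rewrite mxE; exact: DE.
Qed.

Lemma is_derive_dot (p q : R -> 'cV[R]_n) (dp dq : 'cV[R]_n) t :
  is_derive t (1 : R) p dp -> is_derive t (1 : R) q dq ->
  is_derive t (1 : R) (fun s => ((p s)^T *m q s) 0 0)
    ((dp^T *m q t) 0 0 + ((p t)^T *m dq) 0 0).
Proof.
move=> hp hq.
have -> : (fun s => ((p s)^T *m q s) 0 0) =
    \sum_i ((fun s => p s i 0) * (fun s => q s i 0)).
  apply/funext => s; rewrite mxE fct_sumE; apply: eq_bigr => i _.
  by rewrite mxE.
have H := is_derive_sum (fun i => is_deriveM (is_derive_coord i hp) (is_derive_coord i hq)).
apply: (is_derive_eq H); rewrite !mxE -big_split; apply: eq_bigr => i _ /=.
by rewrite !mxE addrC /GRing.scale /= [q t i 0 * _]mulrC.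
Qed.

Lemma absolutely_continuous_dot (p q : R -> 'cV[R]_n) :
  absolutely_continuous 0 T p -> absolutely_continuous 0 T q ->
  absolutely_continuous 0 T (fun s => ((p s)^T *m q s) 0 0).
Proof.
move=> acp acq.
have -> : (fun s => ((p s)^T *m q s) 0 0) = (fun s => \sum_i p s i 0 * q s i 0).
  by apply/funext => s; rewrite mxE; apply: eq_bigr => i _; rewrite mxE.
apply: absolutely_continuous_sum => i; apply: (absolutely_continuousM (ltW T0));
  exact: absolutely_continuous_coord.
Qed.

End first_variation.

(** * The convex variation and its consequence for a pair of indices *)

Section switching.
Context {R : realType}.
Notation mu := (@lebesgue_measure R).

(** The primitive is nondecreasing, starts at [0] and ends at most at [0], so it is constant on
    [[0, T]] and its derivative [g] vanishes almost everywhere. *)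
Lemma primitive_le0_ae_eq0 (T C : R) (g : R -> R) : 0 <= T ->
  measurable_fun `[0, T]%classic g ->
  (forall t, t \in `[0, T] -> 0 <= g t <= C) ->
  primitive T g T <= 0 -> \forall t \ae mu, t \in `[0, T] -> g t = 0.
Proof.
move=> T0 mg g0C FT.
have gC t : t \in `[0, T] -> `|g t| <= C.
  by move=> /g0C/andP[g0 gC]; rewrite ger0_norm.
have acF := primitive_absolutely_continuous mg gC.
have dF := primitive_is_derive mg gC.
have ndF s t : 0 <= s -> s <= t -> t <= T -> primitive T g s <= primitive T g t.
  move=> s0 st tT; rewrite -subr_ge0 -(subrr 0).
  apply: (absolutely_continuous_increment_le (f := fun=> 0) st).
  - exact: absolutely_continuous_cst.
  - exact: absolutely_continuousS acF.
  apply: filterS dF => y dy; rewrite in_itv/= => /andP[sy yt].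
  have y0T : y \in `[0, T] by rewrite in_itv/= (le_trans s0)// (le_trans yt).
  exists 0, (g y); split; [exact: is_derive_cst|exact: dy|].
  by have /andP[] := g0C y y0T.
have F0 t : 0 <= t <= T -> primitive T g t = 0.
  move=> /andP[t0 tT]; apply/eqP; rewrite eq_le (le_trans (ndF _ _ _ tT _) FT)//=.
  by rewrite -{1}(primitive0 T g) ndF.
(* Away from the endpoints the primitive is zero on a whole neighbourhood, as the two-sided
   derivative requires. *)
apply: filterS3 (ae_neq 0) (ae_neq T) dF => t tn0 tnT dt t0T.
have [_ <-] := dt t0T.
rewrite (@near_eq_derive _ _ _ _ (cst 0)) ?derive_cst//.
move: t0T; rewrite in_itv/= => /andP[t0 tT].
have : t \in `]0, T[ by rewrite in_itv/= !lt_neqAle eq_sym tn0 t0 tnT tT.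
move=> /near_in_itvoo; apply: filterS => s; rewrite in_itv/= => /andP[s0 sT].
by rewrite F0// !ltW.
Qed.

Variables (n r : nat) (A : 'I_r -> 'M[R]_n) (x0 : 'cV[R]_n) (T : R).
Variables (u : R -> 'cV[R]_r) (x lam : R -> 'cV[R]_n).
Hypotheses (n0 : (0 < n)%N) (T0 : 0 < T) (hopt : optimal A x0 T u)
  (hx : trajectory A x0 T u x) (hlam : adjoint A T u x lam).
Local Notation m := (switching A x lam).

Lemma mixD_transfer (w v : R -> 'cV[R]_r) t c i k :
  v t = w t + c *: (delta_mx k 0 - delta_mx i 0) ->
  mix A v t = mix A w t + c *: (A k - A i).
Proof.
move=> vE; rewrite /mix.
have pick l : A l = \sum_(j < r) (delta_mx l 0 : 'cV[R]_r) j 0 *: A j.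
  rewrite (bigD1 l)//= big1 ?mxE ?eqxx ?scale1r ?addr0// => j jl.
  by rewrite mxE (negPf jl) scale0r.
rewrite (pick k) (pick i) -sumrB scaler_sumr -big_split/=; apply: eq_bigr => l _.
have -> : v t l 0 = w t l 0 + c * ((delta_mx k 0 : 'cV[R]_r) l 0 -
    (delta_mx i 0 : 'cV[R]_r) l 0) by rewrite vE !mxE.
by rewrite scalerDl -scalerA scalerBl.
Qed.

Lemma admissible_transfer (w : 'cV[R]_r) c i k : i != k -> 0 <= c <= w i 0 ->
  (forall l, 0 <= w l 0) /\ \sum_l w l 0 = 1 ->
  let v := w + c *: (delta_mx k 0 - delta_mx i 0) in
  (forall l, 0 <= v l 0) /\ \sum_l v l 0 = 1.
Proof.
move=> ik /andP[c0 cw] [w0 w1] v; split => [l|].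
  rewrite !mxE eqxx !andbT; have [->|li] := eqVneq l i.
    by rewrite (negPf ik) sub0r mulrN1 subr_ge0.
  by rewrite subr0 addr_ge0// mulr_ge0.
rewrite -[RHS]w1 -[RHS]addr0 [LHS](eq_bigr
    (fun l => w l 0 + c * ((l == k)%:R - (l == i)%:R))).
  rewrite big_split/= -mulr_sumr sumrB; congr (_ + _).
  have sum1 j : \sum_(l < r) (l == j)%:R = 1 :> R.
    by rewrite (bigD1 j)//= eqxx big1 ?addr0// => l /negPf->.
  by rewrite !sum1 subrr mulr0.
by move=> l _; rewrite !mxE !eqxx !andbT.
Qed.

Lemma switching_pair i k : i != k ->
  \forall t \ae mu, t \in `[0, T] -> m k t < m i t -> u t i 0 = 0.
Proof.
move=> ik.
have T0' := ltW T0.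
pose phi t := Num.max 0 (m i t - m k t).
have acphi : absolutely_continuous 0 T phi.
  (* Taking the positive part does not increase distances. *)
  apply: (absolutely_continuous_dominated (C := 1) (f := fun t => m i t - m k t)).
    move=> s t _ _ _; rewrite mul1r /phi.
    move: (m i t - m k t) (m i s - m k s) => a b.
    have := ler_norm (a - b); have := ler_norm (- (a - b)); rewrite normrN ler_norml.
    by case: (leP 0 a) => ?; case: (leP 0 b) => ? h1 h2; apply/andP; split; lra.
  apply: absolutely_continuousD; first exact: (switching_ac T0 hx hlam).
  by apply: absolutely_continuousN; exact: (switching_ac T0 hx hlam).
have phi0 t : 0 <= phi t by rewrite le_max lexx.
have mphi : measurable_fun `[0, T]%classic phi.
  apply: subspace_continuous_measurable_fun => //.
  exact: absolutely_continuous_within.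
have [Phi Phi0 phiPhi] := absolutely_continuous_bounded T0' acphi.
have [Bx Bx0 xB] := absolutely_continuous_bounded T0' hx.1.1.
have [Bl Bl0 lamB] := absolutely_continuous_bounded T0' hlam.1.1.
have [w [mw w1 wu]] := borel_control i hopt.1.
pose N := A k - A i; pose S := mx_sum_norm N.
have S0 : 0 <= S by exact: mx_sum_norm_ge0.
(* The amount transferred is [e * g]. The factor [w t i 0] keeps it within what index [i] holds once
   [e * phi t <= 1]. *)
pose g t := phi t * w t i 0.
have mg : measurable_fun `[0, T]%classic g by exact: measurable_funM.
have wi t : t \in `[0, T] -> 0 <= w t i 0 <= 1.
  move=> t0T; have [w0 <-] := w1 t t0T.
  by rewrite w0 (bigD1 i)//= lerDl sumr_ge0.
have g0 t : t \in `[0, T] -> 0 <= g t <= Phi.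
  move=> t0T; have /andP[wi0 wi1] := wi t t0T; rewrite mulr_ge0//= -[leRHS]mulr1.
  by rewrite ler_pM// (le_trans _ (phiPhi t t0T))// ler_norm.
(* [G] is [phi ^+ 2] times [w t i 0], the rate of first-order decrease; its vanishing forces
   [w t i 0 = 0] wherever [phi t > 0]. *)
pose G t := phi t * g t.
have mG : measurable_fun `[0, T]%classic G by exact: measurable_funM.
have G0 t : t \in `[0, T] -> 0 <= G t <= Phi * Phi.
  move=> t0T; have /andP[gt0 gtP] := g0 t t0T; rewrite mulr_ge0//=.
  by rewrite ler_pM// (le_trans _ (phiPhi t t0T))// ler_norm.
suff FT : primitive T G T <= 0.
  apply: filterS2 wu (primitive_le0_ae_eq0 T0' mG G0 FT) => t wu Gt t0T mki.
  have phit : 0 < phi t by rewrite lt_max subr_gt0 mki orbT.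
  rewrite -wu//; have /eqP := Gt t0T.
  by rewrite !mulf_eq0 gt_eqF//= => /eqP.
pose E := expR ((2 * (n%:R * \sum_l mx_sum_norm (A l)) + 1) * T).
(* [e * H] bounds the forcing [f], whence [2 * (e * H) * E] bounds [D]. Per unit of [e ^+ 2], the
   two terms of [K] bound the remainder in [p] and half of [disagreement (D T)]. *)
pose H := Phi * (S * Bx).
pose K := Phi * (n%:R * (Bl * (S * (2 * H * E)))) * T + n%:R * 2 * (2 * H * E) ^+ 2.
have H0 : 0 <= H by rewrite !mulr_ge0.
have E0 : 0 <= E by exact: expR_ge0.
have K0 : 0 <= K by rewrite addr_ge0// !mulr_ge0// ?sqr_ge0.
suff small e : 0 < e -> e * (Phi + 1) <= 1 -> primitive T G T <= e * K.
  rewrite leNgt; apply/negP => FT.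
  have Phi1 : 0 < Phi + 1 by rewrite ltr_wpDl.
  have K1 : 0 < K + 1 by rewrite ltr_wpDl.
  (* The first entry makes the variation admissible. With the second, a positive integral [F] would
     satisfy [F <= F * K / (K + 1) < F]. *)
  pose e := Num.min (Phi + 1)^-1 (primitive T G T / (K + 1)).
  have : primitive T G T <= e * K.
    apply: small; first by rewrite lt_min invr_gt0 Phi1 divr_gt0.
    by rewrite -ler_pdivlMr// div1r ge_min lexx.
  rewrite leNgt => /negP; apply.
  apply: (@le_lt_trans _ _ (primitive T G T / (K + 1) * K)).
    by rewrite ler_wpM2r// ge_min lexx orbT.
  by rewrite mulrAC ltr_pdivrMr// ltr_pM2l// ltrDl.
move=> e0 ePhi.
pose v t := w t + (e * g t) *: (delta_mx k 0 - delta_mx i 0).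
pose f t := (e * g t) *: (N *m x t).
have egt t : t \in `[0, T] -> 0 <= e * g t <= w t i 0.
  move=> t0T; have /andP[wi0 wi1] := wi t t0T.
  rewrite mulr_ge0 ?(ltW e0) ?(andP (g0 t t0T)).1//= /g mulrA ler_piMl//.
  rewrite (le_trans _ ePhi)// ler_wpM2l ?(ltW e0)//.
  by rewrite (le_trans (le_trans (ler_norm _) (phiPhi t t0T)))// lerDl.
have v1 t : t \in `[0, T] -> (forall l, 0 <= v t l 0) /\ \sum_l v t l 0 = 1.
  by move=> t0T; apply: admissible_transfer => //; [exact: egt|exact: w1].
have mv l : measurable_fun `[0, T]%classic (fun t => v t l 0).
  have -> : (fun t => v t l 0) = (fun t => w t l 0 + e * g t *
      (delta_mx k 0 - delta_mx i 0 : 'cV[R]_r) l 0).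
    by apply/funext => t; rewrite mxE [in X in _ + X]mxE.
  apply: measurable_funD => //; apply: measurable_funM => //.
  exact: measurable_funM.
have mf j : measurable_fun `[0, T]%classic (fun t => f t j 0).
  have -> : (fun t => f t j 0) =
      (fun t => e * g t * \sum_b N j b * x t b 0).
    by apply/funext => t; rewrite mxE [in X in _ * X]mxE.
  apply: measurable_funM; first exact: measurable_funM.
  apply: measurable_sum => b; apply: measurable_funM => //.
  apply: subspace_continuous_measurable_fun => //.
  by apply: absolutely_continuous_within; exact: absolutely_continuous_coord hx.1.1.
have fH t j : t \in `[0, T] -> `|f t j 0| <= e * H.
  move=> t0T; have /andP[gt0 gtP] := g0 t t0T.
  have /andP[egt0 _] := egt t t0T.
  rewrite mxE normrM ger0_norm// -mulrA ler_wpM2l ?(ltW e0)//.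
  apply: ler_pM => //; apply: mulmx_cV_le => // b.
  exact: le_trans (norm_coord_le _ _ _) (xB t t0T).
have [D [D0 acD dD DE]] := perturbation A T0 mv v1 mf fH.
pose y t := x t + D t.
have mixv t : mix A v t = mix A w t + (e * g t) *: N by exact: mixD_transfer.
have hy : trajectory A x0 T v y.
  split; last by rewrite /y D0 addr0 hx.2.
  split; first exact: absolutely_continuousD hx.1.1 acD.
  apply: filterS3 hx.1.2 wu dD => t dx wut dDt t0T.
  apply: (is_derive_eq (is_deriveD (dx t0T) (dDt t0T))).
  rewrite (_ : mix A u t = mix A w t); last by rewrite /mix wut.
  rewrite mulmxDr addrA addrAC; congr (_ + _).
  by rewrite mixv mulmxDl -scalemxAl.
have adm : admissible T v.
  split=> // l; exact: borel_lebesgue_measurable.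
have Vle := hopt.2 v x y adm hx hy.
pose p t := ((lam t)^T *m D t) 0 0.
have acp : absolutely_continuous 0 T p.
  by apply: absolutely_continuous_dot => //; exact: hlam.1.1.
pose q t := ((lam t)^T *m (N *m D t)) 0 0.
(* The adjoint equation cancels the terms in [mix A w]. What remains is [e * g t * q t] and
   [e * g t * (m k t - m i t)], and the latter equals [- e * G t]. *)
have dp : \forall t \ae mu, t \in `[0, T] ->
    is_derive t (1 : R) p (e * g t * q t - e * G t).
  apply: filterS3 hlam.1.2 wu dD => t dl wut dDt t0T.
  apply: (is_derive_eq (is_derive_dot (dl t0T) (dDt t0T))).
  have -> : mix A u t = mix A w t by rewrite /mix wut.
  have addE (X Y : 'M[R]_1) : (X + Y) 0 0 = X 0 0 + Y 0 0 by rewrite mxE.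
  have oppE (X : 'M[R]_1) : (- X) 0 0 = - X 0 0 by rewrite mxE.
  have scaleE a (X : 'M[R]_1) : (a *: X) 0 0 = a * X 0 0 by rewrite mxE.
  have -> : (- (mix A w t)^T *m lam t)^T = - ((lam t)^T *m mix A w t).
    by rewrite mulNmx linearN/= trmx_mul trmxK.
  rewrite mixv mulmxDl !mulmxDr -scalemxAl -!scalemxAr mulNmx -mulmxA.
  rewrite !addE oppE !scaleE -/(q t).
  have -> : ((lam t)^T *m (N *m x t)) 0 0 = m k t - m i t.
    by rewrite /N mulmxBl mulmxBr !mulmxA addE oppE.
  have phimE : phi t * (m k t - m i t) = - (phi t * phi t).
    by rewrite /phi; case: leP => _; rewrite ?mul0r ?oppr0// -mulrN opprB.
  rewrite /G /g; transitivity (e * phi t * w t i 0 * q t +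
    e * w t i 0 * (phi t * (m k t - m i t))); first by ring.
  by rewrite phimE; ring.
have GB t : t \in `[0, T] -> `|G t| <= Phi * Phi.
  by move=> /G0/andP[Gt0 GtP]; rewrite ger0_norm.
have dF := primitive_is_derive mG GB.
have qB t : t \in `[0, T] -> `|q t| <= n%:R * (Bl * (S * (2 * (e * H) * E))).
  move=> t0T; apply: dot_le => j.
    exact: le_trans (norm_coord_le _ _ _) (lamB t t0T).
  apply: mulmx_cV_le => [|b]; last exact: DE.
  by rewrite !mulr_ge0 ?(ltW e0).
pose c := e * Phi * (n%:R * (Bl * (S * (2 * (e * H) * E)))).
(* In the derivative of [p + e * primitive T G] the terms in [G] cancel, leaving [e * g t * q t],
   which is at most [c], of order [e ^+ 2]. *)
have pF : p T + e * primitive T G T <= c * T.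
  have -> : p T + e * primitive T G T =
      (p T + e * primitive T G T) - (p 0 + e * primitive T G 0).
    have p0 : p 0 = 0 by rewrite /p D0 mulmx0 mxE.
    by rewrite primitive0 p0 mulr0 addr0 subr0.
  have -> : c * T = c * T - c * 0 by rewrite mulr0 subr0.
  apply: (absolutely_continuous_increment_le
    (f := fun t => p t + e * primitive T G t) (g := fun t => c * t) T0').
  - apply: absolutely_continuousD => //; apply: absolutely_continuousZ.
    exact: primitive_absolutely_continuous GB.
  - apply: absolutely_continuousZ.
    apply: (absolutely_continuous_lipschitz (C := 1)) => s t _ st _.
    by rewrite mul1r ger0_norm ?subr_ge0.
  apply: filterS2 dp dF => t dpt dFt t0T.
  exists (e * g t * q t - e * G t + e * G t), (c * 1); split.
  - exact: is_deriveD (dpt t0T) (is_deriveZ e (dFt t0T)).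
  - have := is_deriveZ c (is_derive_id t (1 : R)); exact.
  have /andP[gt0 gtP] := g0 t t0T.
  rewrite subrK mulr1 (le_trans (ler_norm _))// normrM.
  have eg0 : 0 <= e * g t by rewrite mulr_ge0 ?(ltW e0).
  by rewrite ger0_norm// ler_pM ?qB// ler_wpM2l ?(ltW e0).
have T0T : T \in `[0, T] by rewrite in_itv/= T0' lexx.
have Vd := disagreement_le n0 (fun j => DE T j T0T).
(* The terminal condition [lam T = P (x T)] identifies the linear term of the expansion with
   [2 * p T]. *)
have := Vle; rewrite /y disagreementD// -hlam.2 -/(p T) => Vp.
rewrite -(ler_pM2l e0).
have -> : e * (e * K) = c * T + n%:R * (2 * (2 * (e * H) * E)) ^+ 2 / 2.
  by rewrite /c /K; field.
by move: Vp Vd pF; rewrite -/E; lra.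
Qed.

End switching.

Theorem theorem1 (R : realType) (n r : nat) (hn : (0 < n)%N) (hr : (2 <= r)%N)
    (A : 'I_r -> 'M[R]_n)
    (hmetzler : forall i, metzler (A i))
    (hrows : forall i, zero_row_sums (A i))
    (x0 : 'cV[R]_n) (T : R) (hT : 0 < T)
    (u : R -> 'cV[R]_r) (hopt : optimal A x0 T u)
    (x : R -> 'cV[R]_n) (hx : trajectory A x0 T u x)
    (lam : R -> 'cV[R]_n) (hlam : adjoint A T u x lam) :
  \forall t \ae (@lebesgue_measure R), t \in `[0, T] ->
    forall i : 'I_r,
      (forall j : 'I_r, j != i ->
         switching A x lam j t < switching A x lam i t) ->
      u t i 0 = 0.
Proof.
have pair i : \forall t \ae (@lebesgue_measure R), t \in `[0, T] ->
    (forall j, j != i -> switching A x lam j t < switching A x lam i t) ->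
    u t i 0 = 0.
  (* Any competitor will do, and [2 <= r] provides one among the indices [0] and [1]. *)
  have [k ik] : exists k : 'I_r, i != k.
    exists (if i == Ordinal (ltnW hr) then Ordinal hr else Ordinal (ltnW hr)).
    by case: (eqVneq i (Ordinal (ltnW hr))) => // ->.
  apply: filterS (switching_pair hn hT hopt hx hlam ik) => t ui t0T im.
  by apply: ui => //; apply: im; rewrite eq_sym.
(* There are finitely many indices, so a single null set serves them all. *)
have : \forall t \ae (@lebesgue_measure R), forall i : 'I_r, t \in `[0, T] ->
    (forall j, j != i -> switching A x lam j t < switching A x lam i t) ->
    u t i 0 = 0 by exact: filter_forall.
by apply: filterS => t ut t0T i; exact: ut.
Qed.
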